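(* Let $n\ge 3$ and let $A$ be an $n$-by-$n$ weighted shift matrix with complex weights $a_1,\ldots,a_n$. Then $$p_A(x,y,z)=z^n+\sum_{r=1}^{\lfloor n/2\rfloor}S_r(|a_1|^2,\ldots,|a_n|^2)(x^2+y^2)^r\left(-\frac14\right)^r z^{n-2r}+\frac{(-1)^{n+1}}{2^n}\left((x-iy)^n\prod_{j=1}^n a_j+(x+iy)^n\prod_{j=1}^n\bar a_j\right).$$
   Context: An $n$-by-$n$ weighted shift matrix with weights $a_1,\ldots,a_n\in\mathbb{C}$ is the matrix whose $(j,j+1)$-entry is $a_j$ for $1\le j\le n-1$, whose $(n,1)$-entry is $a_n$, and whose other entries are all $0$. For an $n$-by-$n$ complex matrix $A$, $\mathrm{Re}\,A=(A+A^* )/2$, $\mathrm{Im}\,A=(A-A^* )/(2i)$, and the Kippenhahn polynomial of $A$ is $p_A(x,y,z)=\det(x\,\mathrm{Re}\,A+y\,\mathrm{Im}\,A+zI_n)$. The circularly symmetric functions are defined by $S_0=1$ and, for $r\ge1$, $S_r(c_1,\ldots,c_n)=\sum_\pi\prod_{k=1}^r c_{\pi(k)}$, where the sum is over all maps $\pi:\{1,\ldots,r\}\to\{1,\ldots,n\}$ such that $\pi(k)+1<\pi(k+1)$ for $1\le k<r$, and such that if $\pi(1)=1$ then $\pi(r)\ne n$. *)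

(* Defs.v *)
From HB Require Import structures.
From mathcomp Require Import all_boot all_order all_algebra.
From mathcomp Require Import complex reals.
From mathcomp Require Import mpoly.
Set Implicit Arguments.
Unset Strict Implicit.
Unset Printing Implicit Defensive.
Import Order.TTheory GRing.Theory Num.Theory.
Local Open Scope ring_scope.
Local Open Scope sesquilinear_scope.

(* Indices are 0-based: a_1, ..., a_n are a 0, ..., a (n - 1). *)

Definition weighted_shift (C : nzRingType) (n : nat) (a : 'I_n -> C) : 'M[C]_n :=
  \matrix_(i, j)
    if (j == i.+1 :> nat) || (i.+1 == n) && (j == 0 :> nat) then a i else 0.

Definition mxRe (C : numClosedFieldType) (n : nat) (A : 'M[C]_n) : 'M[C]_n :=
  2^-1 *: (A + A ^t*).

Definition mxIm (C : numClosedFieldType) (n : nat) (A : 'M[C]_n) : 'M[C]_n :=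
  (2 * 'i)^-1 *: (A - A ^t*).

Definition Px (C : nzRingType) : {mpoly C[3]} := 'X_(0 : 'I_3).
Definition Py (C : nzRingType) : {mpoly C[3]} := 'X_(1 : 'I_3).
Definition Pz (C : nzRingType) : {mpoly C[3]} := 'X_(2 : 'I_3).
Arguments Px {C}.
Arguments Py {C}.
Arguments Pz {C}.

Definition kippenhahn (C : numClosedFieldType) (n : nat) (A : 'M[C]_n) :
    {mpoly C[3]} :=
  \det (Px *: map_mx (@mpolyC 3 C) (mxRe A) + Py *: map_mx (@mpolyC 3 C) (mxIm A)
        + Pz%:M).

(* With 0-based values, pi 1 = 1 reads s ord0 = 0 and pi r = n reads
   (s ord_max).+1 = n; the gap condition is invariant under the shift. *)
Definition circ_sparse (n r : nat) (s : {ffun 'I_r.+1 -> 'I_n}) : bool :=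
  [forall k : 'I_r.+1, forall l : 'I_r.+1,
     (l == k.+1 :> nat) ==> ((s k).+1 < s l)%N]
  && ((s ord0 == 0 :> nat) ==> ((s ord_max).+1 != n)).

Definition circ_sym (C : comNzRingType) (n r : nat) (c : 'I_n -> C) : C :=
  if r is r'.+1 then
    \sum_(s : {ffun 'I_r'.+1 -> 'I_n} | circ_sparse s) \prod_(k < r'.+1) c (s k)
  else 1.

(* Main.v *)
Require Import Defs.
From HB Require Import structures.
From mathcomp Require Import all_boot all_order all_algebra.
From mathcomp Require Import complex reals.
From mathcomp Require Import mpoly.
From mathcomp Require Import zify ring.
Set Implicit Arguments.
Unset Strict Implicit.
Unset Printing Implicit Defensive.
Import Order.TTheory GRing.Theory Num.Theory.
Local Open Scope ring_scope.

(** The matrix x Re A + y Im A + z is cyclically tridiagonal: z on the diagonal,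
    a_j u above it and the conjugate of a_j times v below it, where
    u = (x - iy)/2 and v = (x + iy)/2, the indices being read around a cycle.
    So its determinant is a sum over the permutations that move every index by
    at most one step around the cycle.  The two rotations contribute
    (-1)^(n+1) (u^n prod a_j + v^n prod conj a_j); every other such permutation is
    a product of r disjoint transpositions of neighbours, that is, an r-matching
    of the n-cycle, and contributes (-1)^r z^(n-2r) times the product of the
    weights |a_j|^2 u v of its edges.  Since S_r is the weight sum of the
    r-matchings of the n-cycle and uv = (x^2+y^2)/4, this is the formula.

    Rather than classify permutations, the proof works with recurrences.  A
    genuinely tridiagonal determinant satisfies the continuant recurrence
    [det_tridiag_rec]; the matching sums of a path satisfy the same one according
    to whether the last edge is used [path_sym_recr], whence [det_tridiag].  To
    close the path into a cycle, the two corner entries are added one at a time;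
    a determinant is affine in each entry, with the cofactor as slope
    [det_add_delta].  The corner cofactors are triangular determinants, which
    give the two products of weights, and one of them also contains the
    determinant of the inner path, which arises when both corners are used.  On
    the combinatorial side this term consists of the cyclic matchings that
    contain the closing edge [circ_symS].  The comparison is made in
    [det_periodic_tridiag], over any commutative ring. *)

(** * Matching sums of paths and cycles *)

Definition gapped (N r : nat) (s : {ffun 'I_r -> 'I_N}) : bool :=
  [forall k : 'I_r, forall l : 'I_r, (k < l)%N ==> ((s k).+1 < s l)%N].

Definition within (N r : nat) (s : {ffun 'I_r -> 'I_N}) (l m : nat) : bool :=
  [forall k, l <= s k < m]%N.

(** Numbering the edges of a path, an increasing sequence without consecutive
    values is a matching; this is the generating sum of the [r]-matchings that
    use only the edges [l], ..., [m - 1].  Keeping the ambient type ['I_N] fixed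
    and moving the window lets recurrences compare sums over the same type. *)
Definition path_sym (R : comNzRingType) (N : nat) (c : 'I_N -> R) (l m r : nat) : R :=
  \sum_(s : {ffun 'I_r -> 'I_N} | gapped s && within s l m)
    \prod_(k < r) c (s k).

Definition fsnoc (T : Type) (r : nat) (s : {ffun 'I_r -> T}) (x : T) :
    {ffun 'I_r.+1 -> T} :=
  [ffun k => oapp s x (unlift ord_max k)].

Lemma fsnoc_max (T : Type) r (s : {ffun 'I_r -> T}) x : fsnoc s x ord_max = x.
Proof. by rewrite ffunE unlift_none. Qed.

Lemma fsnoc_lift (T : Type) r (s : {ffun 'I_r -> T}) x k :
  fsnoc s x (lift ord_max k) = s k.
Proof. by rewrite ffunE liftK. Qed.

Lemma fsnoc_widen (T : Type) r (s : {ffun 'I_r -> T}) x (k : 'I_r) h :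
  fsnoc s x (widen_ord h k) = s k.
Proof.
rewrite -(fsnoc_lift s x); congr (fsnoc _ _ _).
by apply/val_inj; rewrite /= /bump leqNgt ltn_ord.
Qed.

Lemma big_fsnoc (R : nmodType) (I : finType) r (P : pred {ffun 'I_r.+1 -> I})
    (F : {ffun 'I_r.+1 -> I} -> R) :
  \sum_(s | P s) F s
  = \sum_(x : I) \sum_(s : {ffun 'I_r -> I} | P (fsnoc s x)) F (fsnoc s x).
Proof.
rewrite (pair_big_dep xpredT) /=.
rewrite (reindex (fun u : I * {ffun 'I_r -> I} => fsnoc u.2 u.1)) //=.
exists (fun s : {ffun 'I_r.+1 -> I} => (s ord_max, [ffun k => s (lift ord_max k)])).
  move=> [x s] _ /=; rewrite fsnoc_max; congr (_, _).
  by apply/ffunP => k; rewrite ffunE fsnoc_lift.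
move=> s _ /=; apply/ffunP => k.
case: (unliftP ord_max k) => [j ->|->]; last by rewrite fsnoc_max.
by rewrite fsnoc_lift ffunE.
Qed.

Lemma gappedP N r (s : {ffun 'I_r -> 'I_N}) :
  reflect (forall k l : 'I_r, (k < l)%N -> ((s k).+1 < s l)%N) (gapped s).
Proof.
apply: (iffP forallP) => [h k l kl|h k].
  by move/forallP: (h k) => /(_ l) /implyP; apply.
by apply/forallP => l; apply/implyP; apply: h.
Qed.

(** Gaps between consecutive terms propagate to all pairs by transitivity; this
    links [gapped] to the condition on neighbours in [circ_sparse]. *)
Lemma gapped_adjacent N r (s : {ffun 'I_r -> 'I_N}) :
  gapped s
  = [forall k : 'I_r, forall l : 'I_r, (l == k.+1 :> nat) ==> ((s k).+1 < s l)%N].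
Proof.
apply/gappedP/forallP => [h k|h k l].
  by apply/forallP => l; apply/implyP => /eqP kl; apply: h; rewrite kl.
move: l => [l lr] /=; elim: l lr => [//|l IH] lr; rewrite ltnS leq_eqVlt => kl.
have lr' : (l < r)%N by lia.
have step : ((s (Ordinal lr')).+1 < s (Ordinal lr))%N.
  by move/forallP: (h (Ordinal lr')) => /(_ (Ordinal lr)) /implyP; apply.
case/orP: kl => [/eqP kl|kl].
  by have -> : k = Ordinal lr' by apply/val_inj.
by have := IH lr' kl; lia.
Qed.

(** Every earlier term of a gapped sequence ending in [j] is below [j - 1], so
    removing the last term leaves a gapped sequence in a shorter window.  For
    [j = 0] the truncated [j.-1] is still right: no term may precede 0. *)
Lemma gapped_fsnoc N r (s : {ffun 'I_r -> 'I_N}) (j : 'I_N) l m :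
  gapped (fsnoc s j) && within (fsnoc s j) l m
  = (l <= j < m)%N && (gapped s && within s l j.-1).
Proof.
apply/andP/and3P => [[/gappedP g /forallP w]|[lj /gappedP g /forallP w]].
  split.
  - by have := w ord_max; rewrite fsnoc_max.
  - apply/gappedP => k k' kk'; have := g (lift ord_max k) (lift ord_max k').
    by rewrite !fsnoc_lift !lift_max; apply.
  apply/forallP => k; have := w (lift ord_max k); rewrite fsnoc_lift.
  have := g (lift ord_max k) ord_max; rewrite fsnoc_lift fsnoc_max lift_max.
  by move=> /(_ (ltn_ord k)); lia.
split.
  apply/gappedP => k k'.
  case: (unliftP ord_max k) => [i ->|->]; case: (unliftP ord_max k') => [i' ->|->];
    rewrite ?fsnoc_lift ?fsnoc_max ?lift_max /=; last 2 first.
  - by rewrite ltnNge (ltnW (ltn_ord i')).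
  - by rewrite ltnn.
  - exact: g.
  - by have := w i; lia.
apply/forallP => k; case: (unliftP ord_max k) => [i ->|->];
  rewrite ?fsnoc_lift ?fsnoc_max //.
by have := w i; lia.
Qed.

Lemma prod_fsnoc (R : comNzRingType) N (c : 'I_N -> R) r (s : {ffun 'I_r -> 'I_N}) j :
  \prod_(k < r.+1) c (fsnoc s j k) = c j * \prod_(k < r) c (s k).
Proof.
rewrite big_ord_recr /= fsnoc_max mulrC; congr (_ * _).
by apply: eq_bigr => k _; rewrite fsnoc_widen.
Qed.

Section PathSym.
Variables (R : comNzRingType) (N : nat) (c : 'I_N -> R).

Lemma path_sym0 l m : path_sym c l m 0 = 1.
Proof.
rewrite /path_sym (eq_bigl xpredT); last first.
  by move=> s; apply/andP; split; apply/forallP; case.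
rewrite (eq_bigr (fun=> 1)) => [|s _]; last by rewrite big_ord0.
by rewrite sumr_const card_ffun !card_ord expn0.
Qed.

Lemma path_symS l m r :
  path_sym c l m r.+1
  = \sum_(j < N | (l <= j < m)%N) c j * path_sym c l j.-1 r.
Proof.
rewrite /path_sym big_fsnoc [RHS]big_mkcond; apply: eq_bigr => j _.
under eq_bigl do rewrite gapped_fsnoc.
case: ifP => _; last by rewrite big_pred0.
by rewrite big_distrr; apply: eq_bigr => s _; rewrite prod_fsnoc.
Qed.

Lemma path_sym_empty l m r : (m <= l)%N -> path_sym c l m r.+1 = 0.
Proof. by move=> ml; rewrite path_symS big_pred0 // => j; lia. Qed.

(** A matching either avoids the last edge [m] or contains it, and in the latter
    case it avoids the edge [m - 1]. *)
Lemma path_sym_recr l (m : 'I_N) r : (l <= m)%N ->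
  path_sym c l m.+1 r.+1
  = path_sym c l m r.+1 + c m * path_sym c l m.-1 r.
Proof.
move=> lm; rewrite !path_symS (bigD1 m) /=; last by lia.
rewrite addrC; congr (_ + _); apply: eq_bigl => j.
by rewrite -(inj_eq val_inj) /=; lia.
Qed.

(** The window [l, l + n - 1) holds the edges of a path with [n] vertices, which
    cannot accommodate [r] disjoint edges when [n < 2r]. *)
Lemma path_sym_long l n r : (l + n <= N.+1)%N -> (n < r.*2)%N ->
  path_sym c l (l + n).-1 r = 0.
Proof.
have [k] := ubnP n; elim: k n r => // k IH [|[|n]] [|r] nk lN nr //;
  try (by rewrite path_sym_empty //; lia).
have mN : (l + n < N)%N by lia.
have -> : (l + n.+2).-1 = (Ordinal mN).+1 by rewrite /=; lia.
rewrite path_sym_recr ?leq_addr //=.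
have -> : path_sym c l (l + n) r.+1 = 0.
  by rewrite (_ : (l + n)%N = (l + n.+1).-1) ?IH //; lia.
by rewrite IH ?mulr0 ?addr0 //; lia.
Qed.

End PathSym.

(** In a cyclic matching that contains the closing edge [n + 1], the edges [0] and
    [n] are excluded and the others form a matching of the window [1, n); the
    remaining cyclic matchings are the matchings of the path obtained by deleting
    the closing edge. *)
Lemma circ_symS (R : comNzRingType) n (c : 'I_n.+2 -> R) r :
  circ_sym r.+1 c
  = path_sym c 0 n.+1 r.+1 + c ord_max * path_sym c 1 n r.
Proof.
rewrite /circ_sym big_fsnoc (bigD1 ord_max) //= addrC path_symS.
congr (_ + _).
  (* Last value below n + 1: the condition on the wrap-around is vacuous. *)
  have lt_max (j : 'I_n.+2) : (0 <= j < n.+1)%N = (j != ord_max).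
    by rewrite -(inj_eq val_inj) /=; have := ltn_ord j; lia.
  under [RHS]eq_bigl do rewrite lt_max.
  apply: eq_bigr => j jn; rewrite /path_sym big_distrr /=.
  apply: eq_big => s; last by rewrite prod_fsnoc.
  have := gapped_fsnoc s j 0 n.+2; rewrite /= ltn_ord /= => <-.
  rewrite /circ_sparse -gapped_adjacent; congr (_ && _).
  rewrite fsnoc_max; move: jn; rewrite -lt_max => jn.
  transitivity true; first by apply/implyP => _; lia.
  by apply/esym/forallP => k; rewrite ltn_ord.
(* Last value n + 1: the wrap-around condition excludes the first value 0. *)
rewrite /path_sym big_distrr /=; apply: eq_big => s; last by rewrite prod_fsnoc.
have g0 := gapped_fsnoc s ord_max 0 n.+2; rewrite /= ltnSn /= in g0.
have wT : within (fsnoc s ord_max) 0 n.+2.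
  by apply/forallP => k; rewrite ltn_ord.
rewrite wT andbT in g0.
rewrite /circ_sparse -gapped_adjacent g0 fsnoc_max /= eqxx /= implybF -andbA.
case: (boolP (gapped s)) => //= /gappedP g.
(* With a single term, first and last coincide, so the condition is n + 1 <> 0. *)
case: r s g0 wT g => [|r] s _ _ g.
  have -> : ord0 = ord_max :> 'I_1 by apply/val_inj.
  rewrite fsnoc_max andbT; transitivity true; last apply/esym.
    by apply/forallP; case.
  by apply/forallP; case.
have -> : fsnoc s ord_max ord0 = s ord0.
  by rewrite -(fsnoc_lift s ord_max); congr (fsnoc _ _ _); apply/val_inj.
apply/andP/idP => [[/forallP w f0]|/forallP w].
  apply/forallP => k; have := w k; rewrite /= => ->; rewrite andbT.
  case: (posnP k) => [k0|k0]; last by have := g ord0 k k0; lia.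
  have -> : k = ord0 by apply/val_inj.
  by lia.
by split; [apply/forallP => k; have := w k; lia|have := w ord0; lia].
Qed.

Lemma eq_circ_sym (R : comNzRingType) n r (c d : 'I_n -> R) :
  c =1 d -> circ_sym r c = circ_sym r d.
Proof.
by move=> cd; case: r => //= r; apply: eq_bigr => s _; apply: eq_bigr => k _.
Qed.

Lemma circ_sym_scale (R : comNzRingType) (A : comAlgType R) n r
    (b : 'I_n -> A) (c : 'I_n -> R) (w : A) :
  (forall j, b j = c j *: w) -> circ_sym r b = circ_sym r c *: w ^+ r.
Proof.
move=> bE; case: r => [|r] /=; first by rewrite expr0 scale1r.
rewrite scaler_suml; apply: eq_bigr => s _.
by under eq_bigr do rewrite bE; rewrite scaler_prod prodr_const card_ord.
Qed.

(** * Tridiagonal determinants *)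

(** The cofactors along row [i] do not see that row, so in the Laplace expansion
    the entry [(i, j)] occurs only as the coefficient of its own cofactor. *)
Lemma det_add_delta (R : comNzRingType) n (A : 'M[R]_n) (i j : 'I_n) (x : R) :
  \det (A + x *: delta_mx i j) = \det A + x * cofactor A i j.
Proof.
have cofE k : cofactor (A + x *: delta_mx i j) i k = cofactor A i k.
  rewrite /cofactor; congr (_ * \det _); apply/matrixP => a b.
  by rewrite !mxE [lift i a == i]eq_sym (negPf (neq_lift _ _)) mulr0 addr0.
rewrite (expand_det_row _ i) (expand_det_row A i).
under eq_bigr => k _ do rewrite cofE !mxE eqxx /= mulrDl.
rewrite big_split /=; congr (_ + _).
rewrite (bigD1 j) //= eqxx mulr1 big1 ?addr0 // => k /negPf ->.
by rewrite mulr0 mul0r.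
Qed.

Section Continuant.
Variables (R : comNzRingType) (z : R) (p q : nat -> R).

Definition tridiag (i j : nat) : R :=
  if i == j then z else if j == i.+1 then p i else if i == j.+1 then q j else 0.

Lemma tridiag_diag i : tridiag i i = z.
Proof. by rewrite /tridiag eqxx. Qed.

Lemma tridiag_super i : tridiag i i.+1 = p i.
Proof. by rewrite /tridiag eqxx ifF //; lia. Qed.

Lemma tridiag_sub i : tridiag i.+1 i = q i.
Proof. by rewrite /tridiag eqxx; do 2 (rewrite ifF; last by lia). Qed.

Lemma tridiag_above i j : (i.+1 < j)%N -> tridiag i j = 0.
Proof. by move=> ij; rewrite /tridiag; do 3 (rewrite ifF; last by lia). Qed.

Lemma tridiag_below i j : (j.+1 < i)%N -> tridiag i j = 0.
Proof. by move=> ij; rewrite /tridiag; do 3 (rewrite ifF; last by lia). Qed.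

(** All the tridiagonal minors below are windows of one infinite matrix, so they
    are indexed by their offset [l] and their size. *)
Definition tridiag_mx (l n : nat) : 'M[R]_n := \matrix_(i, j) tridiag (l + i) (l + j).

(** Continuant recurrence: expand along the last row, whose two nonzero entries
    are on and next to the diagonal, and the second cofactor along its last
    column, which has a single nonzero entry. *)
Lemma det_tridiag_rec l n :
  \det (tridiag_mx l n.+2)
  = z * \det (tridiag_mx l n.+1) - p (l + n)%N * q (l + n)%N * \det (tridiag_mx l n).
Proof.
pose m : 'I_n.+2 := widen_ord (leqnSn n.+1) ord_max.
have entry (i j : 'I_n.+2) : tridiag_mx l n.+2 i j = tridiag (l + i) (l + j).
  by rewrite mxE.
have cof_diag : cofactor (tridiag_mx l n.+2) ord_max ord_max = \det (tridiag_mx l n.+1).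
  rewrite /cofactor addnn -signr_odd odd_double mul1r; congr (\det _).
  by apply/matrixP => i j; rewrite !mxE !lift_max.
have lift_m (i : 'I_n) : lift m (widen_ord (leqnSn n) i) = i :> nat.
  by rewrite /= /bump leqNgt ltn_ord.
have lift_m' : lift m (ord_max : 'I_n.+1) = n.+1 :> nat.
  by rewrite /= /bump leqnn.
have cof_next : cofactor (tridiag_mx l n.+2) ord_max m
    = - (p (l + n)%N * \det (tridiag_mx l n)).
  rewrite /cofactor /= addSn addnn -signr_odd /= odd_double expr1 mulN1r.
  congr (- _); rewrite (expand_det_col _ ord_max) big_ord_recr /= big1 => [|i _].
    rewrite add0r !mxE lift_max lift_m' /= addnS tridiag_super.
    congr (_ * _); rewrite /cofactor addnn -signr_odd odd_double mul1r.
    congr (\det _); apply/matrixP => i j; rewrite !mxE !lift_max.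
    congr (tridiag _ (l + _)).
    rewrite -[RHS]lift_m; congr (nat_of_ord (lift _ _)).
    by apply/val_inj; rewrite /= /bump leqNgt ltn_ord.
  rewrite !mxE lift_max lift_m' /= tridiag_above ?mul0r //.
  by have := ltn_ord i; lia.
rewrite (expand_det_row _ ord_max) big_ord_recr /= big_ord_recr /= big1 => [|i _].
  rewrite add0r -/m cof_diag cof_next !entry /= !addnS tridiag_sub tridiag_diag.
  ring.
by rewrite entry /= tridiag_below ?mul0r //; have := ltn_ord i; lia.
Qed.

(** The number [b] of summands is free as long as [n < 2b], all the terms beyond
    [n / 2] being zero: the two smaller determinants of the recurrence can then be
    expanded with ranges that match that of the larger one. *)
Lemma det_tridiag N (c : 'I_N -> R) (l n b : nat) :
  (forall j : 'I_N, c j = p j * q j) -> (l + n <= N.+1)%N -> (n < b.*2)%N ->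
  \det (tridiag_mx l n)
  = \sum_(r < b) (-1) ^+ r
      * path_sym c l (l + n).-1 r * z ^+ (n - r.*2).
Proof.
move=> cE; have [k] := ubnP n; elim: k n b => // k IH [|[|n]] [|b] // nk lN nb.
- rewrite det_mx00 big_ord_recl path_sym0 big1 /= ?mulr1 ?addr0 // => i _.
  by rewrite path_sym_long ?mulr0 ?mul0r.
- rewrite det_mx11 mxE tridiag_diag big_ord_recl path_sym0 big1 /= ?mul1r ?addr0 // => i _.
  by rewrite path_sym_long ?mulr0 ?mul0r // /bump /=; lia.
have mN : (l + n < N)%N by lia.
rewrite det_tridiag_rec (IH n.+1 b.+1) 1?(IH n b); [|lia..].
rewrite !big_ord_recl !path_sym0 !mulr1 !mul1r !subn0 mulrDr -exprS -addrA.
congr (_ + _); rewrite !big_distrr -sumrB; apply: eq_bigr => r _ /=.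
have -> : bump 0 r = r.+1 by [].
have -> : (n.+2 - r.+1.*2 = n - r.*2)%N by lia.
rewrite (_ : (l + n.+2).-1 = (Ordinal mN).+1); last by rewrite /=; lia.
rewrite path_sym_recr ?leq_addr //= cE /= (_ : (l + n.+1).-1 = (l + n)%N); last by lia.
have -> : z * ((-1) ^+ r.+1 * path_sym c l (l + n) r.+1 * z ^+ (n.+1 - r.+1.*2))
  = (-1) ^+ r.+1 * path_sym c l (l + n) r.+1 * z ^+ (n - r.*2).
  (* When 2(r + 1) > n + 1 the exponent is truncated, but the sum vanishes. *)
  have [long|short] := ltnP n.+1 r.+1.*2.
    have := @path_sym_long _ _ c l n.+1 r.+1; rewrite addnS /= => -> //; last by lia.
    by rewrite mulr0 !mul0r mulr0.
  by rewrite mulrCA -exprS; congr (_ * _ ^+ _); lia.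
rewrite exprS; ring.
Qed.
End Continuant.

(** * Closing the cycle *)

(** Adding the corners [p_(n-1)] at the lower left and [q_(n-1)] at the upper
    right to the tridiagonal [T] gives
    [det T + p_(n-1) C + q_(n-1) (C' + p_(n-1) D)] up to signs, where [C] and [C'] are
    the products of the other weights and [D] is the determinant of [T] without
    its first and last vertices.  For [n = 2] the corners would be the entries next
    to the diagonal. *)
Lemma det_periodic_tridiag (R : comNzRingType) (n : nat) (z : R) (p q : 'I_n -> R) :
  (3 <= n)%N ->
  \det (z%:M + weighted_shift p + (weighted_shift q)^T)
  = z ^+ n
    + \sum_(1 <= r < n./2.+1)
        (-1) ^+ r * circ_sym r (fun j => p j * q j) * z ^+ (n - r.*2)
    + (-1) ^+ n.+1 * (\prod_j p j + \prod_j q j).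
Proof.
case: n p q => [|[|[|n]]] // p q _.
pose p' j := p (inord j); pose q' j := q (inord j).
pose T := tridiag_mx z p' q' 0 n.+3.
(* The minor of T at the upper right corner: it is upper triangular, with the
   weights q on its diagonal. *)
pose S := \matrix_(i < n.+2, j < n.+2) tridiag z p' q' i.+1 j.
have -> : z%:M + weighted_shift p + (weighted_shift q)^T
    = T + p ord_max *: delta_mx ord_max ord0 + q ord_max *: delta_mx ord0 ord_max.
  apply/matrixP => i j; rewrite !mxE.
  have pE : p ord_max * ((i == ord_max) && (j == ord0))%:R
      = if (i == n.+2 :> nat) && (j == 0 :> nat) then p i else 0.
    rewrite -!(inj_eq val_inj) /=.
    case: eqP => [im|_] /=; last by rewrite mulr0.
    have -> : i = ord_max by apply/val_inj.
    by case: eqP => _; rewrite ?mulr1 ?mulr0.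
  have qE : q ord_max * ((i == ord0) && (j == ord_max))%:R
      = if (j == n.+2 :> nat) && (i == 0 :> nat) then q j else 0.
    rewrite -!(inj_eq val_inj) /= andbC.
    case: eqP => [jm|_] /=; last by rewrite mulr0.
    have -> : j = ord_max by apply/val_inj.
    by case: eqP => _; rewrite ?mulr1 ?mulr0.
  rewrite pE qE /tridiag /p' /q' !inord_val !eqSS -(inj_eq val_inj) /= !add0n.
  have := ltn_ord i; have := ltn_ord j => lt_j lt_i.
  repeat (case: eqP => ? /=); rewrite ?mulr1n ?mulr0n ?addr0 ?add0r //; exfalso; lia.
have cofT : cofactor T ord_max ord0 = (-1) ^+ n.+2 * \prod_(j < n.+2) p' j.
  rewrite /cofactor addn0; congr (_ * _); rewrite det_trig.
    by apply: eq_bigr => i _; rewrite !mxE lift_max lift0 tridiag_super.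
  by apply/is_trig_mxP => i j ij; rewrite !mxE lift_max lift0 tridiag_above.
have detS : \det S = \prod_(j < n.+2) q' j.
  rewrite -det_tr det_trig.
    by apply: eq_bigr => i _; rewrite !mxE tridiag_sub.
  by apply/is_trig_mxP => i j ij; rewrite !mxE tridiag_below.
have cofS : cofactor S ord_max ord0
    = (-1) ^+ n.+1 * \det (tridiag_mx z p' q' 1 n.+1).
  rewrite /cofactor addn0; congr (_ * \det _).
  by apply/matrixP => i j; rewrite !mxE lift_max lift0.
have cofT' : cofactor (T + p ord_max *: delta_mx ord_max ord0) ord0 ord_max
    = (-1) ^+ n.+2 * (\det S + p ord_max * cofactor S ord_max ord0).
  rewrite /cofactor -/(cofactor S ord_max ord0) -det_add_delta; congr (_ * \det _).
  apply/matrixP => i j; rewrite !mxE !lift_max !lift0.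
  have -> : (lift ord0 i == ord_max) = (i == ord_max) by rewrite -!(inj_eq val_inj).
  have -> // : (lift ord_max j == ord0) = (j == ord0).
  by rewrite -!(inj_eq val_inj) /= /bump leqNgt ltn_ord.
have prodE (f : 'I_n.+3 -> R) : \prod_j f j = \prod_(j < n.+2) f (inord j) * f ord_max.
  rewrite big_ord_recr; congr (_ * _); apply: eq_bigr => j _; congr f.
  by apply/val_inj; rewrite /= inordK //; have := ltn_ord j; lia.
rewrite !det_add_delta cofT cofT' detS cofS !prodE -/(\prod_(j < n.+2) p' j).
pose c j := p j * q j.
have cE (j : 'I_n.+3) : c j = p' j * q' j by rewrite /p' /q' inord_val.
rewrite /T (det_tridiag _ (l := 0) (b := n.+3./2.+1) cE) //; last by lia.
rewrite (det_tridiag _ (l := 1) (b := n.+3./2) cE); [|lia..].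
rewrite [\sum_(r < n.+3./2.+1) _]big_ord_recl path_sym0 !mul1r subn0 big_add1 big_mkord.
have -> : \sum_(r < n.+3./2) (-1) ^+ r.+1 * circ_sym r.+1 c * z ^+ (n.+3 - r.+1.*2)
  = \sum_(r < n.+3./2) (-1) ^+ r.+1 * path_sym c 0 n.+2 r.+1 * z ^+ (n.+3 - r.+1.*2)
    - c ord_max * \sum_(r < n.+3./2) (-1) ^+ r * path_sym c 1 n.+1 r * z ^+ (n.+1 - r.*2).
  rewrite [c ord_max * _]big_distrr -sumrB; apply: eq_bigr => r _.
  rewrite circ_symS (_ : (n.+3 - r.+1.*2 = n.+1 - r.*2)%N); last by lia.
  rewrite exprS /=; ring.
have signs (X Y a b P Q : R) :
  z ^+ n.+3 + X + a * ((-1) ^+ n.+2 * P)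
    + b * ((-1) ^+ n.+2 * (Q + a * ((-1) ^+ n.+1 * Y)))
  = z ^+ n.+3 + (X - a * b * Y) + (-1) ^+ n.+4 * (P * a + Q * b).
  have sq : (-1) ^+ n * (-1) ^+ n = 1 :> R by rewrite -expr2 sqrr_sign.
  by rewrite (exprS _ n.+3) !(exprS (-1)); ring: sq.
exact: signs.
Qed.

(** * The Kippenhahn polynomial *)

(** The weights are scalars and [u], [v], [z] live in an algebra over them, so that
    the determinant separates into scalar symmetric functions of the weights and
    monomials in [u], [v], [z]. *)
Definition shift_pencil (R : comNzRingType) (A : comAlgType R) (n : nat)
    (a b : 'I_n -> R) (u v z : A) : 'M[A]_n :=
  z%:M + weighted_shift (fun j => a j *: u) + (weighted_shift (fun j => b j *: v))^T.

Lemma det_shift_pencil (R : comNzRingType) (A : comAlgType R) (n : nat)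
    (a b : 'I_n -> R) (u v z : A) : (3 <= n)%N ->
  \det (shift_pencil a b u v z)
  = z ^+ n
    + \sum_(1 <= r < n./2.+1)
        ((-1) ^+ r * circ_sym r (fun j => a j * b j)) *: ((u * v) ^+ r * z ^+ (n - r.*2))
    + (-1) ^+ n.+1 *: ((\prod_j a j) *: u ^+ n + (\prod_j b j) *: v ^+ n).
Proof.
move=> hn; rewrite det_periodic_tridiag //.
have sign_scale k (x : A) : (-1) ^+ k * x = (-1) ^+ k *: x.
  by rewrite -signr_odd mulr_sign -[in RHS]signr_odd scaler_sign.
congr (_ + _ + _); last by rewrite sign_scale !scaler_prod !prodr_const card_ord.
apply: eq_bigr => r _.
rewrite (circ_sym_scale _ (c := fun j => a j * b j) (w := u * v)).
  by rewrite sign_scale -!scalerAl scalerA.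
by move=> j; rewrite -scalerAl -scalerAr scalerA.
Qed.

Lemma half_conj_factors (C : numClosedFieldType) (A : comAlgType C) (x y : A) :
  (2^-1 *: (x - 'i *: y)) * (2^-1 *: (x + 'i *: y)) = (1 / 4) *: (x ^+ 2 + y ^+ 2).
Proof.
rewrite -scalerAl -scalerAr scalerA -subr_sqr exprZn sqrCi scaleN1r opprK.
by congr (_ *: _); field.
Qed.

(** Here [u v = (x^2 + y^2) / 4], and each edge carries the weight
    [a_j conj(a_j) = |a_j|^2]. *)
Lemma det_hermitian_shift_pencil (C : numClosedFieldType) (A : comAlgType C) (n : nat)
    (a : 'I_n -> C) (x y z : A) : (3 <= n)%N ->
  \det (shift_pencil a (fun j => (a j)^*)
          (2^-1 *: (x - 'i *: y)) (2^-1 *: (x + 'i *: y)) z) =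
    z ^+ n
    + \sum_(1 <= r < (n %/ 2).+1)
        (circ_sym r (fun j => `|a j| ^+ 2) * (- (1 / 4)) ^+ r)
          *: ((x ^+ 2 + y ^+ 2) ^+ r * z ^+ (n - 2 * r))
    + ((-1) ^+ n.+1 / 2 ^+ n)
        *: ((\prod_(j < n) a j) *: (x - 'i *: y) ^+ n
            + (\prod_(j < n) (a j)^*) *: (x + 'i *: y) ^+ n).
Proof.
move=> hn; rewrite det_shift_pencil // divn2; congr (_ + _ + _).
  apply: eq_bigr => r _.
  have -> : circ_sym r (fun j => a j * (a j)^*) = circ_sym r (fun j => `|a j| ^+ 2).
    by apply: eq_circ_sym => j; rewrite normCK.
  have -> : (2^-1 *: (x - 'i *: y)) * (2^-1 *: (x + 'i *: y))
      = (1 / 4) *: (x ^+ 2 + y ^+ 2) :> A.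
    exact: half_conj_factors.
  rewrite mul2n exprZn -scalerAl scalerA [in RHS]exprNn; congr (_ *: _).
  ring.
rewrite !exprZn -exprVn -[in RHS]scalerA; congr (_ *: _).
by rewrite scalerDr !scalerA; congr (_ *: _ + _ *: _); rewrite mulrC.
Qed.

(** Collecting the coefficients of [A] and of its adjoint in [x Re A + y Im A]
    gives [x/2 + y/(2i) = (x - iy)/2] and [x/2 - y/(2i) = (x + iy)/2]. *)
Lemma kippenhahn_pencil (C : numClosedFieldType) (n : nat) (a : 'I_n -> C) :
  kippenhahn (weighted_shift a)
  = \det (shift_pencil a (fun j => (a j)^*) (2^-1 *: (Px - 'i *: Py))
            (2^-1 *: (Px + 'i *: Py)) Pz : 'M[{mpoly C[3]}]_n).
Proof.
congr (\det _); apply/matrixP => i j; rewrite !mxE.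
rewrite [LHS]addrC -[RHS]addrA; congr (_ + _).
set P := (X in X + _^*); set Q := (X in P + X^*).
transitivity (P *: (2^-1 *: (Px - 'i *: Py)) + Q^* *: (2^-1 *: (Px + 'i *: Py)) : {mpoly C[3]}).
  have -> : (2 * 'i)^-1 = - (2^-1 * 'i) :> C by rewrite invfM invCi mulrN.
  rewrite -!mul_mpolyC !(mpolyCM, mpolyCD, mpolyCN, mpolyCB).
  by ring.
by congr (_ + _); rewrite /P /Q; case: ifP => _; rewrite ?conjC0 ?scale0r.
Qed.

Lemma kippenhahn_weighted_shift (C : numClosedFieldType) (n : nat) (a : 'I_n -> C) :
  (3 <= n)%N ->
  kippenhahn (weighted_shift a) =
    Pz ^+ n
    + \sum_(1 <= r < (n %/ 2).+1)
        (circ_sym r (fun j => `|a j| ^+ 2) * (- (1 / 4)) ^+ r)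
          *: ((Px ^+ 2 + Py ^+ 2) ^+ r * Pz ^+ (n - 2 * r))
    + ((-1) ^+ n.+1 / 2 ^+ n)
        *: ((\prod_(j < n) a j) *: (Px - 'i *: Py) ^+ n
            + (\prod_(j < n) (a j)^*) *: (Px + 'i *: Py) ^+ n).
Proof.
move=> hn; rewrite kippenhahn_pencil.
exact: det_hermitian_shift_pencil.
Qed.

Unset Implicit Arguments.

Theorem theorem4p2 (R : realType) (n : nat) (hn : (3 <= n)%N)
    (a : 'I_n -> R[i]) :
  kippenhahn (weighted_shift a) =
    Pz ^+ n
    + \sum_(1 <= r < (n %/ 2).+1)
        (circ_sym r (fun j => `|a j| ^+ 2) * (- (1 / 4)) ^+ r)
          *: ((Px ^+ 2 + Py ^+ 2) ^+ r * Pz ^+ (n - 2 * r))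
    + ((-1) ^+ n.+1 / 2 ^+ n)
        *: ((\prod_(j < n) a j) *: (Px - 'i *: Py) ^+ n
            + (\prod_(j < n) (a j)^*) *: (Px + 'i *: Py) ^+ n).
Proof.
exact: kippenhahn_weighted_shift.
Qed.
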